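(* For every fixed integer $d \ge 2$, $$\lim_{t \rightarrow \infty} \frac{\operatorname{scc}(K_t(d))}{\frac{d}{2}\, t\log_2 t}=1,$$ where $K_t(d)$ denotes the complete $t$-partite graph with each part of size $d$ and $\operatorname{scc}$ denotes the sigma clique cover number.
   Context: A clique of a graph $G$ is a complete subgraph of $G$; its size is its number of vertices. A clique covering of a graph $G$ is a set $\mathcal{C}$ of cliques of $G$ such that every edge of $G$ is contained in at least one of the cliques in $\mathcal{C}$. The weight of a clique covering $\mathcal{C}$ is $\sum_{C\in\mathcal{C}}|C|$, the sum of the sizes of its cliques. The sigma clique cover number $\operatorname{scc}(G)$ is the smallest possible weight of a clique covering of $G$. $K_t(d)$ is the graph on $td$ vertices partitioned into $t$ parts of size $d$, in which two vertices are adjacent if and only if they lie in different parts. *)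

(* Defs.v *)
From mathcomp Require Import all_boot all_order all_algebra.
From mathcomp Require Import classical_sets reals topology normedtype sequences exp.

Set Implicit Arguments.
Unset Strict Implicit.
Unset Printing Implicit Defensive.

Record sgraph := SGraph {
  vertex : finType;
  adj : rel vertex;
  adj_sym : symmetric adj;
  adj_irr : irreflexive adj
}.

Section CliqueCovering.
Variable G : sgraph.
Implicit Types (C : {set vertex G}) (F : {set {set vertex G}}).

(* In a simple graph a complete subgraph is determined by its vertex set. *)
Definition clique C : bool :=
  [forall x in C, forall y in C, (x != y) ==> adj x y].

Definition clique_covering F : bool :=
  [forall C in F, clique C] &&
  [forall x, forall y, adj x y ==> [exists C in F, (x \in C) && (y \in C)]].

Definition weight F : nat := \sum_(C in F) #|C|.

Definition all_cliques : {set {set vertex G}} := [set C | clique C]%SET.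

Lemma all_cliques_covering : clique_covering all_cliques.
Proof.
apply/andP; split; first by apply/'forall_implyP => C; rewrite inE.
apply/forallP => x; apply/forallP => y; apply/implyP => xy.
apply/existsP; exists [set x; y]%SET; rewrite !inE !eqxx orbT !andbT.
apply/'forall_implyP => u /set2P[] ->; apply/'forall_implyP => v /set2P[] ->;
  by rewrite ?eqxx ?xy ?implybT // adj_sym xy implybT.
Qed.

(* The minimisation starts from all_cliques, a clique covering of G by
   all_cliques_covering, so the minimum is attained by a clique covering. *)
Definition scc : nat :=
  weight [arg min_(F < all_cliques | clique_covering F) weight F].

Lemma scc_attained : exists2 F, clique_covering F & weight F = scc.
Proof.
by rewrite /scc; case: arg_minnP => [|F FP _];
  [exact: all_cliques_covering | exists F].
Qed.

Lemma scc_le F : clique_covering F -> scc <= weight F.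
Proof.
by rewrite /scc; case: arg_minnP => [|F0 _ min FP];
  [exact: all_cliques_covering | exact: min].
Qed.

End CliqueCovering.

Section CompleteMultipartite.
Variables t d : nat.

(* The vertex (i, a) is the a-th vertex of the i-th part. *)
Definition multipartite_adj : rel ('I_t * 'I_d) := fun x y => x.1 != y.1.

Lemma multipartite_adj_sym : symmetric multipartite_adj.
Proof. by move=> x y; rewrite /multipartite_adj eq_sym. Qed.

Lemma multipartite_adj_irr : irreflexive multipartite_adj.
Proof. by move=> x; rewrite /multipartite_adj eqxx. Qed.

Definition complete_multipartite : sgraph :=
  SGraph multipartite_adj_sym multipartite_adj_irr.

End CompleteMultipartite.

Definition log2 (R : realType) (x : R) : R := (ln x / ln 2)%R.

(* Main.v *)
(** A clique of K_t(d) is a partial function from the parts to 'I_d.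

    Lower bound: fix a covering and let S(i,a) be the set of its cliques through
    the vertex (i,a). For a <> b the sets S(i,a), S(i,b) are disjoint while S(i,a)
    meets S(j,b) for i <> j, so a random set of cliques separates S(i,a) from S(i,b)
    for at most one i; hence the sum over i of 2^-(|S(i,a)| + |S(i,b)|) is at
    most 1, and by convexity the sum of |S(i,a)| + |S(i,b)| is at least
    t log2 t. Averaging over the pairs (a, a+1) gives d/2 t log2 t.

    Upper bound (Gargano, Korner and Vaccaro): one needs t words over 'I_d of
    length about d/2 log2 t such that any two of them show every pair of distinct
    letters (a,b) at some position. Take words with m occurrences of each letter.
    For one pair {a,b}, identifying a with b labels the words so that each class has
    'C(2m,m) words and is good for that pair. Labellings for different pairs are
    merged, at negligible cost in rate, by passing to long words of blocks
    (separable_chain), and a largest class of the merged labelling is the code. *)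

Require Import Defs.
From mathcomp Require Import all_boot all_order all_algebra zify ring lra.

Set Implicit Arguments.
Unset Strict Implicit.
Unset Printing Implicit Defensive.

(** * Labellings with good classes *)

(** Equivalently, the graph joining distinct [x], [y] for which [g x y] or [g y x] fails has a
    proper colouring with at most [K] colours. *)
Definition separable (T : finType) (g : T -> T -> Prop) (K : nat) :=
  exists (B : finType) (f : T -> B),
    #|B| <= K /\ forall x y, f x = f y -> x != y -> g x y.

Lemma separable_imset (T B : finType) (g : T -> T -> Prop) (f : T -> B) :
  (forall x y, f x = f y -> x != y -> g x y) -> separable g #|f @: T|.
Proof.
move=> sep; have fA x : f x \in f @: T by apply: imset_f.
exists {b | b \in f @: T}, (fun x => exist _ (f x) (fA x)).
split; first by rewrite card_sig.
by move=> x y [/sep].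
Qed.

Lemma separable_leq (T : finType) (g : T -> T -> Prop) (K K' : nat) :
  K <= K' -> separable g K -> separable g K'.
Proof. by move=> le [B [f [cB sep]]]; exists B, f; split=> //; apply: leq_trans le. Qed.

(** Labels in ['I_K.+1] can be subtracted, this type being a cyclic group; the difference labelling
    of [separable_chain] relies on that. *)
Lemma separable_ord (T : finType) (g : T -> T -> Prop) (K : nat) :
  separable g K.+1 ->
  exists f : T -> 'I_K.+1, forall x y, f x = f y -> x != y -> g x y.
Proof.
move=> [B [f [cB sep]]]; exists (fun x => inord (enum_rank (f x))) => x y e.
apply: sep; apply/enum_rank_inj/val_inj.
have /= := congr1 (@nat_of_ord _) e; rewrite !inordK //;
  exact: leq_trans (ltn_ord _) cB.
Qed.

Lemma separable_power (T I : finType) (g : T -> T -> Prop) (K : nat) :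
  separable g K ->
  separable (fun x y : {ffun I -> T} => exists i, g (x i) (y i)) (K ^ #|I|).
Proof.
move=> [B [f [cB sep]]].
exists {ffun I -> B}, (fun x : {ffun I -> T} => [ffun i => f (x i)]).
split; first by rewrite card_ffun; case: #|I| => // n; rewrite leq_exp2r.
move=> x y /ffunP e nxy.
have /existsP[i ni] : [exists i, x i != y i].
  apply: contraR nxy; rewrite negb_exists => /forallP eq.
  by apply/eqP/ffunP => i; have := eq i; rewrite negbK => /eqP.
by exists i; apply: sep ni; have := e i; rewrite !ffunE.
Qed.

(* Label a word x of blocks by the differences f1 (x_l) - f2 (x_(l-1)). For two
   distinct words with equal labels, f1 agrees on the first block where they
   differ and f2 agrees on the last one; only one extra label is spent. *)
Lemma separable_chain (T : finType) (g1 g2 : T -> T -> Prop) (K L : nat) :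
  separable g1 K.+1 -> separable g2 K.+1 ->
  separable (fun x y : {ffun 'I_L.+1 -> T} =>
    (exists l, g1 (x l) (y l)) /\ exists l, g2 (x l) (y l)) (K.+1 ^ L.+2).
Proof.
move=> /separable_ord[f1 sep1] /separable_ord[f2 sep2].
(* [F1] is padded by 0 after the last block, and [F2], shifted by one, by 0 before the first; this
   gives [L.+2] differences for [L.+1] blocks. *)
pose F1 (x : {ffun 'I_L.+1 -> T}) (l : nat) : 'I_K.+1 :=
  if l < L.+1 then f1 (x (inord l)) else 0%R.
pose F2 (x : {ffun 'I_L.+1 -> T}) (l : nat) : 'I_K.+1 :=
  if l is l'.+1 then f2 (x (inord l')) else 0%R.
pose D x := [ffun l : 'I_L.+2 => (F1 x l - F2 x l)%R].
exists {ffun 'I_L.+2 -> 'I_K.+1}, D.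
split; first by rewrite card_ffun !card_ord.
move=> x y /ffunP eD nxy.
have eDn l : l < L.+2 -> (F1 x l - F2 x l = F1 y l - F2 y l)%R.
  by move=> lL; have := eD (Ordinal lL); rewrite !ffunE.
pose P l := (l < L.+1) && (x (inord l) != y (inord l)).
have exP : exists l, P l.
  have /existsP[i ni] : [exists i, x i != y i].
    apply: contraR nxy; rewrite negb_exists => /forallP eq.
    by apply/eqP/ffunP => i; have := eq i; rewrite negbK => /eqP.
  by exists i; rewrite /P ltn_ord inord_val.
have ubP l : P l -> l <= L by case/andP.
split.
  case: (ex_minnP exP) => l /andP[lL nl] lmin; exists (inord l).
  apply: sep1 nl.
  have e2 : F2 x l = F2 y l.
    case: l lL lmin => // l lL lmin; rewrite /F2; congr f2.
    apply/eqP; apply: contraTT (ltnSn l) => nl.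
    by rewrite -leqNgt; apply: lmin; rewrite /P nl (ltnW lL).
  by have := eDn l (ltnW lL); rewrite e2 => /GRing.addIr; rewrite /F1 lL.
case: (ex_maxnP exP ubP) => l /andP[lL nl] lmax; exists (inord l).
apply: sep2 nl.
have e1 : F1 x l.+1 = F1 y l.+1.
  rewrite /F1; case: ifP => // lL1; congr f1.
  apply/eqP; apply: contraTT (ltnSn l) => nl.
  by rewrite -leqNgt; apply: lmax; rewrite /P nl lL1.
by have := eDn l.+1 lL; rewrite e1 => /GRing.addrI/GRing.oppr_inj.
Qed.

Lemma separable_uncurry (T I J : finType)
    (g : {ffun J * I -> T} -> {ffun J * I -> T} -> Prop)
    (h : {ffun J -> {ffun I -> T}} -> {ffun J -> {ffun I -> T}} -> Prop) (K : nat) :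
  let curry (x : {ffun J * I -> T}) := [ffun j => [ffun i => x (j, i)]] in
  (forall x y, h (curry x) (curry y) -> g x y) ->
  separable h K -> separable g K.
Proof.
move=> curry hg [B [f [cB sep]]]; exists B, (f \o curry); split=> // x y /sep e nxy.
apply: hg; apply: e; apply: contra nxy => /eqP/ffunP e; apply/eqP/ffunP=> -[j i].
by have /ffunP/(_ i) := e j; rewrite !ffunE.
Qed.

(** With roots the bound reads [K^(1/#|I|) <= K0 * #|T|^(1/e)]: for large [e], merging costs a
    factor close to 1 per block. By induction on [s], the tail is merged at the finer precision
    [2 * e], and chaining it with one more relation uses up the rest. *)
Lemma separable_all (T : finType) (P : eqType) (g : P -> T -> T -> Prop)
    (K0 : nat) (s : seq P) (e : nat) :
  0 < K0 <= #|T| -> 0 < e -> (forall p, p \in s -> separable (g p) K0) ->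
  exists (I : finType) (K : nat),
    [/\ 0 < #|I|, K ^ e <= K0 ^ (e * #|I|) * #|T| ^ #|I| &
      separable (fun x y : {ffun I -> T} =>
        forall p, p \in s -> exists i, g p (x i) (y i)) K].
Proof.
move=> /andP[K0_gt0 leK0]; have T_gt0 := leq_trans K0_gt0 leK0.
elim: s e => [|p s IH] e e_gt0 sep.
  exists unit, 1; split; first by rewrite card_unit.
    by rewrite exp1n muln_gt0 !expn_gt0 K0_gt0 T_gt0.
  by exists unit, (fun=> tt); rewrite card_unit; split.
have [||I [K [I_gt0 leK sepK]]] := IH (2 * e); first by rewrite muln_gt0.
  by move=> q qs; apply: sep; rewrite inE qs orbT.
set l := #|I| in I_gt0 leK.
(* Chaining wants the same number of labels for both relations: the larger of [K] and [K0 ^ l],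
   which is positive and hence a successor. *)
have [K1 [leK1 leKK1 leK0K1]] :
    exists K1, [/\ K1.+1 ^ (2 * e) <= K0 ^ (2 * e * l) * #|T| ^ l,
                   K <= K1.+1 & K0 ^ l <= K1.+1].
  have mgt0 : 0 < maxn K (K0 ^ l) by rewrite leq_max expn_gt0 K0_gt0 orbT.
  exists (maxn K (K0 ^ l)).-1; rewrite prednK // leq_maxl leq_maxr; split=> //.
  case: (leqP K (K0 ^ l)) => _ //.
  by rewrite -expnM mulnC leq_pmulr // expn_gt0 T_gt0.
(* With this [L], the excess factor [K0 ^ (2 * e * l)] due to the extra label is at most
   [#|T| ^ (L * l)], exactly the slack between the precisions [2 * e] and [e]. *)
pose L := 2 * e.
have sepp : separable (fun x y : {ffun I -> T} => exists i, g p (x i) (y i)) K1.+1.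
  apply: separable_leq leK0K1 _; apply: separable_power; apply: sep.
  by rewrite inE eqxx.
have := separable_chain L sepp (separable_leq leKK1 sepK).
set h := fun x y => _ /\ _ => seph.
exists ('I_L.+1 * I)%type, (K1.+1 ^ L.+2); rewrite card_prod card_ord; split.
- by rewrite muln_gt0.
- rewrite -(leq_exp2r _ _ (isT : 0 < 2)) -!expnM.
  rewrite -/l expnMn -!expnM.
  have -> : L.+2 * (e * 2) = 2 * e * L.+2 by lia.
  rewrite expnM; apply: (@leq_trans ((K0 ^ (2 * e * l) * #|T| ^ l) ^ L.+2)).
    by rewrite leq_exp2r.
  rewrite expnMn -!expnM.
  have -> : 2 * e * l * L.+2 = e * (L.+1 * l) * 2 + 2 * e * l by lia.
  rewrite expnD -mulnA leq_mul2l; apply/orP; right.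
  have -> : L.+1 * l * 2 = L * l + l * L.+2 by lia.
  rewrite expnD leq_mul2r; apply/orP; right.
  by rewrite /L leq_exp2r // !muln_gt0 e_gt0.
- apply: separable_uncurry seph => x y [[j [i]]]; rewrite !ffunE => gp [j' gs].
  move=> q; rewrite inE => /predU1P[->|qs]; first by exists (j, i).
  by have [i'] := gs q qs; rewrite !ffunE; exists (j', i').
Qed.

Lemma fiber_pigeonhole (U B : finType) (f : U -> B) :
  0 < #|U| -> exists b, #|U| <= #|[set x | f x == b]| * #|B|.
Proof.
move=> /card_gt0P[u0 _]; pose F b := #|[set x | f x == b]|.
have [b _ bmax] := @arg_maxnP _ (f u0) xpredT F isT.
exists b; rewrite -[X in X <= _]sum1_card (partition_big f (mem B)) //=.
rewrite mulnC -sum_nat_const; apply: leq_sum => c _; apply: leq_trans (bmax c isT).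
by rewrite /F -sum1_card; apply: eq_leq; apply: eq_bigl => x; rewrite inE.
Qed.

Lemma leq_card_fibers (U B : finType) (f : U -> B) (N : nat) :
  (forall x, N <= #|[set y | f y == f x]|) -> #|f @: U| * N <= #|U|.
Proof.
move=> fibN; rewrite -[X in _ <= X]sum1_card -sum_nat_const.
rewrite (partition_big f (mem (f @: U))) /=; last by move=> x _; apply: imset_f.
apply: leq_sum => c /imsetP[x _ ->]; apply: leq_trans (fibN x) _.
by rewrite -sum1_card; apply: eq_leq; apply: eq_bigl => y; rewrite inE.
Qed.

(** * Balanced words and codes *)

Definition balanced (X D : finType) (m : nat) (x : {ffun X -> D}) :=
  [forall a, #|[set k | x k == a]| == m].

Lemma balancedP (X D : finType) (m : nat) (x : {ffun X -> D}) :
  reflect (forall a, #|[set k | x k == a]| = m) (balanced m x).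
Proof. exact: 'forall_eqP. Qed.

Notation balanced_word X D m := {x : {ffun X -> D} | balanced m x}.

Section Collapse.
Variables (X D : finType) (m : nat) (a b : D).
Hypothesis ab : a != b.
Implicit Types (x y : balanced_word X D m).

Definition collapse (x : balanced_word X D m) : {ffun X -> D} :=
  [ffun k => if val x k == b then a else val x k].

(** The letter [a] is equally frequent in [x] and [y]. If every [a] of [x] faces an [a] of [y],
    these positions coincide and [x = y]; otherwise some [a] of [x] faces another letter, which can
    only be [b] since the collapsed words agree. *)
Lemma collapse_separated x y : collapse x = collapse y -> x != y ->
  exists k, val x k = a /\ val y k = b.
Proof.
move=> /ffunP exy nxy.
pose A (z : balanced_word X D m) := [set k | val z k == a].
have cA z : #|A z| = m by have /balancedP := valP z; apply.
have ba : (b == a) = false by rewrite eq_sym; apply: negbTE.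
have [/subsetP sub|/subsetPn[k]] := boolP (A x \subset A y); last first.
  rewrite !inE => /eqP xk yk; exists k; split=> //.
  have := exy k; rewrite !ffunE xk (negbTE ab).
  by case: eqP => // _ ya; rewrite -ya eqxx in yk.
case/negP: nxy; apply/eqP/val_inj/ffunP => k.
have /setP/(_ k) : A x = A y by apply/eqP; rewrite eqEcard !cA leqnn andbT; apply/subsetP.
rewrite !inE; have := exy k; rewrite !ffunE.
case: (eqVneq (val x k) b) => [->|xb]; case: (eqVneq (val y k) b) => [-> //|yb].
- by move=> <-; rewrite eqxx ba.
- by move=> ->; rewrite eqxx ba.
- by [].
Qed.

(** The [2m] positions where [x] shows [a] or [b] can be refilled, with any [m] of them taken for
    [a], without changing the collapsed word. *)
Lemma collapse_fiber x : 'C(m.*2, m) <= #|[set y | collapse y == collapse x]|.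
Proof.
pose P c := [set k | val x k == c].
have cP c : #|P c| = m by have /balancedP := valP x; apply.
have ba : (b == a) = false by rewrite eq_sym; apply: negbTE.
have dis : [disjoint P a & P b].
  rewrite disjoint_subset; apply/subsetP => k; rewrite !inE => /eqP ->.
  by rewrite (negbTE ab).
pose U := P a :|: P b.
have cU : #|U| = m.*2 by rewrite cardsU disjoint_setI0 // cards0 subn0 !cP addnn.
pose w (Q : {set X}) : {ffun X -> D} :=
  [ffun k => if k \in U then (if k \in Q then a else b) else val x k].
pose Qs := [set Q : {set X} | Q \subset U & #|Q| == m].
have wa (Q : {set X}) : Q \in Qs -> [set k | w Q k == a] = Q.
  rewrite inE => /andP[/subsetP sQ _]; apply/setP => k; rewrite !inE ffunE.
  have := sQ k; rewrite !inE; case: (eqVneq (val x k) a) => [-> _|na].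
    by case: (k \in Q); rewrite ?eqxx ?ba.
  case: (eqVneq (val x k) b) => [-> _|nb] /=; first by case: (k \in Q); rewrite ?eqxx ?ba.
  by rewrite (negbTE na); case: (k \in Q) => // /(_ isT).
have wbal Q : Q \in Qs -> balanced m (w Q).
  move=> QQ; apply/balancedP => c.
  have [->|na] := eqVneq c a; first by move: (QQ); rewrite wa // inE => /andP[_ /eqP].
  have [->|nb] := eqVneq c b.
    have -> : [set k | w Q k == b] = U :\: Q.
      apply/setP => k; rewrite !inE ffunE !inE.
      case: (eqVneq (val x k) a) => [_|_] /=.
        by case: (k \in Q); rewrite ?eqxx ?(negbTE ab).
      case: (eqVneq (val x k) b) => [_|nb] /=; last by rewrite (negbTE nb) andbF.
      by case: (k \in Q); rewrite ?eqxx ?(negbTE ab).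
    move: QQ; rewrite inE => /andP[sQ /eqP cQ].
    by rewrite cardsD (setIidPr sQ) cU cQ -addnn addnK.
  rewrite -(cP c); apply: eq_card => k; rewrite !inE ffunE !inE.
  case: (eqVneq (val x k) a) => [->|_] /=.
    rewrite [a == c]eq_sym (negbTE na).
    by case: (k \in Q); rewrite eq_sym ?(negbTE na) ?(negbTE nb).
  case: (eqVneq (val x k) b) => [->|_] //=.
  rewrite [b == c]eq_sym (negbTE nb).
  by case: (k \in Q); rewrite eq_sym ?(negbTE na) ?(negbTE nb).
have -> : 'C(m.*2, m) = #|Qs| by rewrite cards_draws cU.
rewrite -(@card_in_imset _ _ (fun Q => insubd x (w Q)) Qs); last first.
  move=> Q Q' QQ QQ' e; rewrite -(wa _ QQ) -(wa _ QQ').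
  by have := congr1 val e; rewrite !val_insubd !wbal // => ->.
apply/subset_leq_card/subsetP => y /imsetP[Q QQ ->]; rewrite inE.
apply/eqP/ffunP => k; rewrite !ffunE val_insubd wbal // ffunE !inE.
move: (val x k) => z; case: (eqVneq z a) => [->|na] /=.
  by rewrite (negbTE ab); case: (k \in Q); rewrite ?eqxx ?(negbTE ab).
case: (eqVneq z b) => [_|nb] /=; last by rewrite (negbTE nb).
by case: (k \in Q); rewrite ?eqxx ?(negbTE ab).
Qed.

Lemma collapse_separable :
  separable (fun x y => exists k, val x k = a /\ val y k = b)
    (#|{: balanced_word X D m}| %/ 'C(m.*2, m)).
Proof.
apply: separable_leq (separable_imset collapse_separated).
rewrite leq_divRL ?bin_gt0 -?addnn ?leq_addr // addnn.
exact: leq_card_fibers collapse_fiber.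
Qed.

End Collapse.

Lemma exists_balanced (D : finType) (m : nat) :
  0 < #|{: balanced_word (D * 'I_m)%type D m}|.
Proof.
apply/card_gt0P; have bal : balanced m [ffun k : D * 'I_m => k.1].
  apply/balancedP => a.
  have -> : [set k | [ffun k0 : D * 'I_m => k0.1] k == a] = (fun i => (a, i)) @: 'I_m.
    apply/setP => -[c i]; rewrite !inE ffunE /=; apply/eqP/imsetP => [->|[j _ [-> _]]] //.
    by exists i.
  by rewrite card_imset ?card_ord // => i j [].
by exists (Sub _ bal).
Qed.

(** The induction uses ['C(2m+2, m+1) = 2(2m+1)/(m+1) * 'C(2m, m)], obtained in two halves through
    ['C(2m+1, m)]. *)
Lemma central_bin_ge (m : nat) : 4 ^ m <= m.*2.+1 * 'C(m.*2, m).
Proof.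
elim: m => [|m IH]; first by rewrite bin0.
have e1 : m.*2.+1 * 'C(m.*2, m) = m.+1 * 'C(m.*2.+1, m).
  have /= -> := mul_bin_diag m.*2.+1 m; congr (_ * _).
  by rewrite -bin_sub; [congr 'C(_, _); lia | lia].
have e2 : m.*2.+2 * 'C(m.*2.+1, m) = m.+1 * 'C(m.*2.+2, m.+1).
  by have /= -> := mul_bin_diag m.*2.+2 m.
rewrite doubleS expnS; nia.
Qed.

(** Pairs of equal letters are left out: constant cliques will cover them. *)
Definition qualitatively_independent (S X D : Type) (c : S -> X -> D) :=
  forall i j, i <> j -> forall a b, a <> b -> exists k, c i k = a /\ c j k = b.

(** A large class has at least [#|T|^l / K] words, and [K] is about [(#|T| / N)^l], so [#|S|] is
    about [N^l], nearly [4^(m * l)]. On the right, the power of [#|D|] bounds the loss from merging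
    and the power of [m.*2.+1] the loss from [central_bin_ge]. *)
Lemma qualitatively_independent_code (D : finType) (m e : nat) :
  1 < #|D| -> 0 < e ->
  exists (l : nat) (S X : finType) (c : S -> X -> D),
    [/\ 0 < l, #|X| = l * (#|D| * m), qualitatively_independent c &
        4 ^ (m * l * e) <=
        #|S| ^ e * #|D| ^ (#|D| * m * l) * m.*2.+1 ^ (l * e)].
Proof.
move=> /card_gt1P[a0 [b0 [_ _ ab0]]] e_gt0.
pose X0 := (D * 'I_m)%type; pose T : finType := balanced_word X0 D m.
pose N := 'C(m.*2, m); pose K0 := #|T| %/ N.
have T_gt0 : 0 < #|T| := exists_balanced D m.
have K0_gt0 : 0 < K0.
  have [B [f [cB _]]] := collapse_separable X0 m ab0.
  have /card_gt0P[x _] := T_gt0; apply: leq_trans cB.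
  by apply/card_gt0P; exists (f x).
have K0N : K0 * N <= #|T| by apply: leq_divM.
pose g (p : D * D) (x y : T) := exists k, val x k = p.1 /\ val y k = p.2.
pose s := [seq p <- enum {: D * D} | p.1 != p.2].
have [||p|I [K [I_gt0 leK [B [F [cB sepF]]]]]] := @separable_all T _ g K0 s e => //.
- by rewrite K0_gt0 leq_div.
- by rewrite mem_filter => /andP[ab _]; apply: collapse_separable.
have [|b hb] := fiber_pigeonhole F; first by rewrite card_ffun expn_gt0 T_gt0.
set S := [set x | F x == b] in hb.
pose c (x : {x | x \in S}) (k : I * X0) := val (val x k.1) k.2.
exists #|I|, {x | x \in S}, (I * X0)%type, c; split=> //.
- by rewrite !card_prod card_ord.
- move=> x y nxy a a' naa'.
  have [|||i [k [xa ya]]] := sepF (val x) (val y) _ _ (a, a').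
  + have := valP x; have := valP y; rewrite !inE => /eqP -> /eqP -> //.
  + by apply/eqP => /val_inj.
  + by rewrite mem_filter mem_enum andbT; apply/eqP.
  by exists (i, k).
rewrite card_sig; set l := #|I|; set M := #|T|.
have hS : M ^ l <= #|S| * K.
  by move: hb; rewrite card_ffun => /leq_trans; apply; rewrite leq_mul2l cB orbT.
have leM : M <= #|D| ^ (#|D| * m).
  apply: leq_trans (_ : #|{ffun X0 -> D}| <= _).
    by rewrite /M card_sig max_card.
  by rewrite card_ffun card_prod card_ord.
have le_exp u v k : u <= v -> u ^ k <= v ^ k by case: k => // k; rewrite leq_exp2r.
have NS : N ^ (e * l) <= #|S| ^ e * M ^ l.
  rewrite -(@leq_pmul2l (K0 ^ (e * l))) ?expn_gt0 ?K0_gt0 // -expnMn.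
  apply: leq_trans (le_exp _ _ _ K0N) _; rewrite [e * l]mulnC expnM.
  apply: leq_trans (le_exp _ _ e hS) _; rewrite expnMn [l * e]mulnC.
  by rewrite mulnCA leq_mul2l leK orbT.
rewrite -mulnA expnM; apply: leq_trans (le_exp _ _ _ (central_bin_ge m)) _.
rewrite expnMn mulnC leq_mul2r; apply/orP; right; rewrite mulnC.
by apply: leq_trans NS _; rewrite leq_mul2l expnM le_exp ?orbT.
Qed.

(** * From codes to clique coverings *)

(** The parts receive distinct words of length [r] over [S]. Each block [q] and position [k] yield a
    clique with one vertex per part; [d] constant cliques join vertices with equal second
    coordinate. *)
Lemma scc_complete_multipartite_le (t d r : nat) (S X : finType)
    (c : S -> X -> 'I_d) :
  qualitatively_independent c -> t <= #|S| ^ r ->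
  scc (complete_multipartite t d) <= t * (#|X| * r + d).
Proof.
move=> qi le_tS.
have le_t : t <= #|{ffun 'I_r -> S}| by rewrite card_ffun card_ord.
pose u (i : 'I_t) : {ffun 'I_r -> S} := enum_val (widen_ord le_t i).
have u_inj : injective u by move=> i j /enum_val_inj/(congr1 val)/= /val_inj.
pose V := vertex (complete_multipartite t d).
pose clq (h : 'I_t -> 'I_d) : {set V} := [set (i, h i) | i : 'I_t].
pose h (k : X * 'I_r + 'I_d) (i : 'I_t) :=
  match k with inl q => c (u i q.2) q.1 | inr a => a end.
pose F : {set {set V}} := [set clq (h k) | k : (X * 'I_r + 'I_d)%type].
apply: leq_trans (_ : weight (F : {set {set vertex (complete_multipartite t d)}}) <= _).
  apply: scc_le; apply/andP; split.
    apply/'forall_implyP => C /imsetP[k _ ->].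
    apply/'forall_implyP => x /imsetP[i _ ->].
    apply/'forall_implyP => y /imsetP[j _ ->].
    by apply/implyP; apply: contra => /eqP /= ->.
  apply/forallP => -[i a]; apply/forallP => -[j b]; apply/implyP => nij.
  have [k [<- <-]] : exists k, h k i = a /\ h k j = b.
    have [->|/eqP nab] := eqVneq a b; first by exists (inr b).
    have /existsP[q nq] : [exists q, u i q != u j q].
      apply: contraR nij; rewrite negb_exists => /forallP eq.
      by apply/eqP/u_inj/ffunP => q; have := eq q; rewrite negbK => /eqP.
    by have [k kk] := qi _ _ (elimN eqP nq) _ _ nab; exists (inl (k, q)).
  by apply/existsP; exists (clq (h k)); rewrite !imset_f.
apply: leq_trans (_ : \sum_(C in F) t <= _).
  by apply: leq_sum => C /imsetP[k _ ->]; rewrite (leq_trans (leq_imset_card _ _)) ?card_ord.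
rewrite sum_nat_const mulnC leq_mul2l; apply/orP; right.
by apply: leq_trans (leq_imset_card _ _) _; rewrite card_sum card_prod !card_ord.
Qed.

(** * The lower bound *)

(** The families [E i] of sets containing [A i] and missing [B i] are pairwise disjoint: an element
    common to [A i] and [B j] excludes a set in both [E i] and [E j]. *)
Lemma cross_intersecting_card (V I : finType) (A B : I -> {set V}) :
  (forall i, [disjoint A i & B i]) ->
  (forall i j, i != j -> A i :&: B j != set0) ->
  \sum_i 2 ^ (#|V| - (#|A i| + #|B i|)) <= 2 ^ #|V|.
Proof.
move=> disAB crossAB; pose E i := [set Q : {set V} | A i \subset Q & [disjoint B i & Q]].
have cardE i : 2 ^ (#|V| - (#|A i| + #|B i|)) <= #|E i|.
  have <- : #|~: (A i :|: B i)| = #|V| - (#|A i| + #|B i|).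
    by rewrite cardsCs setCK cardsU disjoint_setI0 // cards0 subn0.
  rewrite -card_powerset.
  rewrite -(@card_in_imset _ _ (fun Q => A i :|: Q) (powerset (~: (A i :|: B i)))).
    apply/subset_leq_card/subsetP => _ /imsetP[Q + ->].
    rewrite powersetE setCU subsetI => /andP[_ sQB].
    rewrite inE subsetUl disjoints_subset setCU subsetI -!disjoints_subset.
    by rewrite disjoint_sym disAB disjoint_sym disjoints_subset.
  move=> Q Q'; rewrite !powersetE !setCU !subsetI => /andP[sQ _] /andP[sQ' _] e.
  have dif (P : {set V}) : P \subset ~: A i -> (A i :|: P) :\: A i = P.
    by move=> sP; rewrite setDUl setDv set0U setDE; apply/setIidPl.
  by rewrite -(dif Q) // e dif.
apply: (@leq_trans (\sum_i #|E i|)); first by apply: leq_sum => i _.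
under eq_bigr => i _ do rewrite -sum1_card big_mkcond /=.
rewrite exchange_big /= -cardsT -card_powerset -[X in _ <= X]sum1_card powersetT.
rewrite [X in _ <= X](eq_bigl xpredT) => [|Q]; last by rewrite inE.
apply: leq_sum => Q _; rewrite -big_mkcond sum1_card /=.
apply/card_le1_eqP => j i Ej Ei.
have : Q \in E j := Ej; rewrite inE => /andP[_ dBj].
have : Q \in E i := Ei; rewrite inE => /andP[sAi _].
apply/eqP; apply: contraTT isT => nij; have /set0Pn[v /setIP[vA vB]] := crossAB _ _ nij.
by have := subsetP sAi _ vA; rewrite (disjointFr dBj).
Qed.

From mathcomp Require Import reals topology normedtype sequences exp.
Import Order.TTheory GRing.Theory Num.Theory.
Import numFieldNormedType.Exports.
Local Open Scope ring_scope.

Lemma sum_pow2_le1 (R : realType) (V I : finType) (A B : I -> {set V}) :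
  (forall i, [disjoint A i & B i]) ->
  (forall i j, i != j -> A i :&: B j != set0) ->
  \sum_i 2 ^- (#|A i| + #|B i|) <= 1 :> R.
Proof.
move=> disAB crossAB; have := cross_intersecting_card disAB crossAB.
rewrite -(ler_nat R) natrX natr_sum.
have pos : 0 < 2 ^+ #|V| :> R by rewrite exprn_gt0.
have leV i : (#|A i| + #|B i| <= #|V|)%N.
  have -> : (#|A i| + #|B i| = #|A i :|: B i|)%N.
    by rewrite cardsU disjoint_setI0 // cards0 subn0.
  exact: max_card.
under eq_bigr => i _ do rewrite natrX exprB ?leV ?unitfE ?pnatr_eq0 //.
by rewrite -mulr_sumr ger_pMr.
Qed.

(* The tangent-line bound 1 + x <= exp x at x = ln #|I| - s i ln 2 plays the
   role of Jensen's inequality. *)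
Lemma sum_ge_card_ln (R : realType) (I : finType) (s : I -> nat) :
  \sum_i 2 ^- s i <= 1 :> R ->
  #|I|%:R * ln (#|I|%:R : R) <= (\sum_i s i)%:R * ln 2.
Proof.
move=> kraft; have [->|I_gt0] := posnP #|I|; first by rewrite mul0r mulr_ge0 ?ln_ge0 ?ler1n.
set n : R := #|I|%:R; have n_gt0 : 0 < n by rewrite ltr0n.
have step i : 1 + (ln n - (s i)%:R * ln 2) <= n * 2 ^- s i.
  apply: le_trans (expR_ge1Dx _) _.
  by rewrite expRD lnK ?posrE // expRN expRM_natl lnK ?posrE.
have : \sum_i (1 + (ln n - (s i)%:R * ln 2)) <= n.
  apply: le_trans (ler_sum _ (fun i _ => step i)) _.
  by rewrite -mulr_sumr ger_pMr.
rewrite big_split /= sumrB -mulr_suml -natr_sum !sumr_const.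
by rewrite -[ln n *+ _]mulr_natl -!/(#|I|%:R) -/n; lra.
Qed.

Lemma weight_sum_degrees (G : sgraph) (F : {set {set vertex G}}) :
  weight F = \sum_(v : vertex G) #|[set C in F | v \in C]|%SET.
Proof.
under eq_bigr => v _ do rewrite -sum1_card big_mkcond.
rewrite exchange_big /= /weight big_mkcond; apply: eq_bigr => C _.
case: ifP => CF; rewrite -?sum1_card ?big_mkcond /=.
  by apply: eq_bigr => v _; rewrite inE CF.
by rewrite big1 // => v _; rewrite inE CF.
Qed.

Lemma scc_complete_multipartite_ge (R : realType) (t d : nat) : (2 <= d)%N ->
  d%:R * (t%:R * ln t%:R) <= 2 * (scc (complete_multipartite t d))%:R * ln (2 : R).
Proof.
move=> d_ge2.
have [F /andP[/'forall_implyP clqF covF] <-] := scc_attained (complete_multipartite t d).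
pose S i a := [set C in F | (i, a) \in C]%SET.
pose sigma a := (\sum_i #|S i a|)%N.
have wE : weight F = (\sum_a sigma a)%N.
  rewrite weight_sum_degrees exchange_big /= pair_big /=.
  by apply: eq_bigr => -[i a].
have sigma2 a : t%:R * ln t%:R <= (sigma a + sigma (ordS a))%:R * ln (2 : R).
  (* [ordS] is the cyclic successor, so [d >= 2] is what makes the two letters differ, also at the
     wrap-around. *)
  have na : a != ordS a.
    apply/negP => /eqP/(congr1 val)/= e.
    have := ltn_ord a; rewrite leq_eqVlt => /predU1P[e'|lt].
      by move: e; rewrite e' modnn; lia.
    by move: e; rewrite modn_small //; lia.
  rewrite /sigma -big_split /= -[in X in X <= _](card_ord t).
  apply/sum_ge_card_ln/sum_pow2_le1 => [i|i j nij].
    rewrite disjoints_subset; apply/subsetP => C; rewrite !inE => /andP[CF ia].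
    rewrite CF; apply/negP => ib.
    have /'forall_implyP/(_ _ ia)/'forall_implyP/(_ _ ib) := clqF _ CF.
    by rewrite xpair_eqE eqxx na /= /multipartite_adj eqxx.
  have /forallP/(_ (i, a))/forallP/(_ (j, ordS a)) := covF.
  move=> /implyP/(_ nij)/existsP[C /and3P[CF iC jC]].
  by apply/set0Pn; exists C; rewrite !inE CF iC jC.
have : \sum_(a < d) (t%:R * ln t%:R) <=
    \sum_(a < d) (sigma a + sigma (ordS a))%:R * ln (2 : R).
  by apply: ler_sum => a _; exact: sigma2.
rewrite sumr_const card_ord -mulr_natl -mulr_suml -natr_sum big_split /=.
(* As [ordS] is a bijection, every [sigma a] is counted twice, which gives [2 * weight F]. *)
rewrite -(reindex_inj (@ordS_inj d) (P := xpredT) (F := sigma)) -wE.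
by rewrite natrD; lra.
Qed.

(** * The upper bound *)

(** Logarithms of the code bound at [e = m], divided by [m]; it is applied with
    [2m + 1 = (2u + 1)^2]. *)
Lemma ln_code_bound (R : realType) (d s m l u : nat) :
  (0 < d)%N -> (0 < m)%N -> (0 < s)%N ->
  (4 ^ (m * l * m) <= s ^ m * d ^ (d * m * l) * ((2 * u).+1 ^ 2) ^ (l * m))%N ->
  l%:R * m%:R * (2 * ln 2) <=
  ln s%:R + l%:R * (d%:R * ln d%:R + 2 * ln (2 * u).+1%:R) :> R.
Proof.
have pos k : (0 < k)%N -> 0 < k%:R :> R by rewrite ltr0n.
move=> /pos d_gt0 /pos m_gt0 /pos s_gt0.
have u_gt0 := pos (2 * u).+1 isT; set v := (2 * u).+1 in u_gt0 *.
have lnX (x : R) n : 0 < x -> ln (x ^+ n) = n%:R * ln x.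
  by move=> x_gt0; rewrite lnXn // mulr_natl.
have ln4 : ln (4 : R) = 2 * ln 2.
  by have -> : 4 = 2 ^+ 2 :> R by [rewrite -natrX]; rewrite lnX.
rewrite -(ler_nat R) !natrM !natrX => h.
rewrite -ler_ln ?posrE ?mulr_gt0 ?exprn_gt0 // in h.
rewrite !lnM ?posrE ?mulr_gt0 ?exprn_gt0 // !lnX ?exprn_gt0 // ln4 !natrM in h.
by rewrite -(ler_pM2l m_gt0); lra.
Qed.

(** As [delta] tends to 0 this says that the length is at most about [d/2 * log2 #|S|]. *)
Lemma efficient_code (R : realType) (d : nat) (delta : R) :
  (2 <= d)%N -> 0 < delta < 2 * ln 2 ->
  exists (S X : finType) (c : S -> X -> 'I_d),
    [/\ qualitatively_independent c, (1 < #|S|)%N &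
        #|X|%:R * (2 * ln 2 - delta) <= d%:R * ln #|S|%:R].
Proof.
move=> d_ge2 /andP[delta_gt0 delta_lt].
have lnd_ge0 : 0 <= ln (d%:R : R) by rewrite ln_ge0 // ler1n; lia.
have dlnd_ge0 : 0 <= d%:R * ln (d%:R : R) by rewrite mulr_ge0.
(* The three terms force [4 <= u * delta], [d ln d <= u * delta] and [1 <= u]. *)
pose y := 4 / delta + d%:R * ln (d%:R : R) / delta + 1.
have y1 : 0 <= 4 / delta by rewrite divr_ge0 // ltW.
have y2 : 0 <= d%:R * ln (d%:R : R) / delta by rewrite divr_ge0 // ltW.
have [u hu] : exists u : nat, y < u%:R.
  by exists (Num.bound y); apply: archi_boundP; rewrite /y; lra.
rewrite /y in hu.
have u4 : 4 <= u%:R * delta by rewrite -ler_pdivrMr //; lra.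
have ud : d%:R * ln (d%:R : R) <= u%:R * delta by rewrite -ler_pdivrMr //; lra.
have u1 : 1 <= u%:R :> R by lra.
have u_gt0 : (0 < u)%N by rewrite -(ltr0n R); lra.
(* This choice makes 2m + 1 = (2u + 1)^2, so that ln (2m + 1) is O(u) while m
   is quadratic in u. *)
pose m := (2 * u ^ 2 + 2 * u)%N.
have m_gt0 : (0 < m)%N by rewrite addn_gt0 !muln_gt0 u_gt0 orbT.
have m2 : (m.*2.+1 = (2 * u).+1 ^ 2)%N by clear; rewrite /m; nia.
have [|l [S [X [c [l_gt0 cX qi]]]]] := @qualitatively_independent_code 'I_d m m _ m_gt0.
  by rewrite card_ord.
rewrite !card_ord m2 in cX * => big.
have S_gt0 : (0 < #|S|)%N.
  by case: posnP big => // ->; rewrite exp0n // !mul0n leqNgt expn_gt0.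
have lnu : ln ((2 * u).+1%:R : R) <= 2 * u%:R.
  by rewrite -natr1 natrM addrC le_ln1Dx //; lra.
have lnS : l%:R * m%:R * (2 * ln 2 - delta) <= ln (#|S|%:R : R).
  have h := @ln_code_bound R d #|S| m l u (ltnW d_ge2) m_gt0 S_gt0 big.
  have mE : m%:R = 2 * u%:R ^+ 2 + 2 * u%:R :> R by rewrite natrD natrM natrX natrM.
  (* Here [2 ln (2u + 1) <= 4u <= u^2 * delta], so the left side is at most [(u^2 + u) * delta]. *)
  have small : d%:R * ln d%:R + 2 * ln ((2 * u).+1%:R : R) <= m%:R * delta.
    rewrite mE; nra.
  have l_ge0 : 0 <= l%:R :> R by [].
  have := ler_wpM2l l_ge0 small; lra.
exists S, X, c; split=> //.
  rewrite ltnNge; apply/negP => S1.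
  have e : #|S| = 1%N by apply/eqP; rewrite eqn_leq S1.
  move: lnS; rewrite e ln1 leNgt => /negP; apply.
  by rewrite !mulr_gt0 ?ltr0n // subr_gt0.
have := ler_wpM2l (ler0n R d) lnS; rewrite cX !natrM; lra.
Qed.

(** One code is fixed before [t], and only its power [r] grows. Rounding [r] up and the constant
    cliques cost [#|X| + d] per part, which [ln t] outgrows. *)
Lemma scc_complete_multipartite_asymp_le (R : realType) (d : nat) (eps : R) :
  (2 <= d)%N -> 0 < eps ->
  exists N : nat, forall t : nat, (N <= t)%N ->
    2 * (scc (complete_multipartite t d))%:R * ln 2 <=
    (1 + eps) * (d%:R * (t%:R * ln (t%:R : R))).
Proof.
move=> d_ge2 eps_gt0; set l2 : R := ln 2.
have l2_gt0 : 0 < l2 by rewrite ln_gt0 // ltr1n.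
have d_gt0 : 0 < d%:R :> R by rewrite ltr0n; lia.
(* Chosen so that [2 <= (1 + eps / 2) * (2 - eta)]; the other [eps / 2] pays for the bounded term
   through [y]. *)
pose eta := Num.min (eps / 2) 1.
have eta_gt0 : 0 < eta by rewrite lt_min; apply/andP; split; lra.
have eta_le : eta <= eps / 2 by rewrite ge_min lexx.
have eta_le1 : eta <= 1 by rewrite ge_min lexx orbT.
pose delta := l2 * eta.
have [|S [X [c [qi S_gt1 rate]]]] := @efficient_code R d delta d_ge2.
  by rewrite mulr_gt0 //=; rewrite /delta -/l2; nra.
have S_gt0 := ltnW S_gt1.
pose y := 4 * l2 * (#|X|%:R + d%:R) / (eps * d%:R).
have N0 := archi_boundP (ltW (expR_gt0 y)).
exists (maxn 2 (Num.bound (expR y))) => t; rewrite geq_max => /andP[t_ge2 t_big].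
have t_gt0 : 0 < t%:R :> R by rewrite ltr0n; lia.
have y_le : y <= ln t%:R.
  rewrite -(expRK y) ler_ln ?posrE ?expR_gt0 //; apply/ltW/(lt_le_trans N0).
  by rewrite ler_nat.
pose r := up_log #|S| t.
have r_gt0 : (0 < r)%N by rewrite up_log_gt0 S_gt1.
have := scc_complete_multipartite_le qi (up_logP t S_gt1); rewrite -/r.
rewrite -(ler_nat R) natrM natrD natrM => hscc.
have hr : (r.-1)%:R * ln #|S|%:R <= ln (t%:R : R).
  rewrite mulr_natl -lnXn ?ltr0n ?S_gt0 // -natrX.
  rewrite ler_ln ?posrE ?ltr0n ?expn_gt0 ?S_gt0 ?(ltnW t_ge2) //.
  by rewrite ler_nat ltnW // up_log_gtn.
have rE : r%:R = (r.-1)%:R + 1 :> R by rewrite natr1 prednK.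
have lin : 2 * l2 * (#|X|%:R * (r.-1)%:R) <= (1 + eps / 2) * (d%:R * ln t%:R).
  apply: (@le_trans _ _ ((1 + eps / 2) * ((r.-1)%:R * (#|X|%:R * (2 * l2 - delta))))).
    have XR : 0 <= #|X|%:R * (r.-1)%:R :> R by rewrite mulr_ge0.
    have h : 2 * l2 <= (1 + eps / 2) * (2 * l2 - delta).
      rewrite /delta; have := mulr_ge0 (ltW l2_gt0) (ltW eps_gt0); nra.
    by have := ler_wpM2r XR h; lra.
  rewrite ler_pM2l; last by lra.
  apply: (@le_trans _ _ ((r.-1)%:R * (d%:R * ln #|S|%:R))); first by rewrite ler_wpM2l.
  by rewrite mulrCA ler_pM2l.
have const : 2 * l2 * (#|X|%:R + d%:R) <= eps / 2 * (d%:R * ln t%:R).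
  by move: y_le; rewrite ler_pdivrMr ?mulr_gt0 //; lra.
have tot : 2 * l2 * (#|X|%:R * r%:R + d%:R) <= (1 + eps) * (d%:R * ln t%:R).
  by rewrite rE; lra.
have l2' : 0 <= 2 * l2 by lra.
have h1 := ler_wpM2l l2' hscc.
have h2 := ler_wpM2l (ltW t_gt0) tot.
lra.
Qed.

(* The limit *)
From mathcomp Require Import classical_sets.
Local Open Scope classical_set_scope.

Theorem corollary8 (R : realType) (d : nat) (hd : (2 <= d)%N) :
  (fun t : nat => (scc (complete_multipartite t d))%:R
                  / (d%:R / 2 * t%:R * log2 t%:R) : R) @ \oo --> (1 : R).
Proof.
apply/cvgrPdist_le => eps eps_gt0.
have [N hN] := scc_complete_multipartite_asymp_le hd eps_gt0.
exists (maxn 2 N) => // t; rewrite /= geq_max => /andP[t_ge2 leNt].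
have l2_gt0 : 0 < ln (2 : R) by rewrite ln_gt0 // ltr1n.
have lt_gt0 : 0 < ln (t%:R : R) by rewrite ln_gt0 // ltr1n.
have t_gt0 : 0 < t%:R :> R by rewrite ltr0n; lia.
have d_gt0 : 0 < d%:R :> R by rewrite ltr0n; lia.
have lower := scc_complete_multipartite_ge R t hd.
have {hN} upper := hN t leNt.
set s : R := _%:R in lower upper *.
set D := d%:R / 2 * t%:R * log2 t%:R.
(* Multiplying by [2 * ln 2] turns the denominator into the expression occurring in both bounds. *)
have DE : D * (2 * ln 2) = d%:R * (t%:R * ln t%:R).
  by rewrite /D /log2; field; rewrite gt_eqF.
have D_gt0 : 0 < D by rewrite /D /log2 !mulr_gt0 ?invr_gt0.
have c_gt0 : 0 < 2 * ln (2 : R) by lra.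
have eD_gt0 : 0 < eps * (d%:R * (t%:R * ln t%:R)) by rewrite !mulr_gt0.
rewrite distrC ler_distl ler_pdivlMr // ler_pdivrMr //.
by apply/andP; split; rewrite -(ler_pM2r c_gt0) -mulrA DE; lra.
Qed.
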